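(* For every positive integer $k\ge 2$, there exist a connected finite simplicial graph $\Gamma_k$ and an element $g\in A(\Gamma_k)$ of syllable length $3$ such that the asymptotic translation length of $g$ on the extension graph $\Gamma_k^e$ is $3+(1/k)$.
   Context: For a finite connected simplicial graph $\Gamma$, $A(\Gamma)=\langle v\in V(\Gamma)\mid [u,v]=1 \text{ for all } \{u,v\}\in E(\Gamma)\rangle$ is its right-angled Artin group. A syllable is an element $v^\ell$ with $v\in V(\Gamma)$, $\ell\in\mathbb{Z}\setminus\{0\}$; the syllable length of $g$ is the smallest number of syllables whose product is $g$. For $x,h\in A(\Gamma)$ write $x^h=h^{-1}xh$. The extension graph $\Gamma^e$ is the simplicial graph with vertex set $\{v^g\mid v\in V(\Gamma), g\in A(\Gamma)\}\subset A(\Gamma)$, where two distinct vertices are joined by an edge exactly when they commute in $A(\Gamma)$. It carries the edge metric $d_{\Gamma^e}$. $A(\Gamma)$ acts on $\Gamma^e$ on the right by conjugation, $x\mapsto x^g$. The asymptotic translation length of $g$ is $\tau(g)=\lim_{n\to\infty} d_{\Gamma^e}(x,x^{g^n})/n$ (independent of the vertex $x$). *)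

(* Defs.v *)
(* MathComp / MathComp-Analysis *)
From HB Require Import structures.
From mathcomp Require Import all_boot all_order all_algebra.
From mathcomp Require Import all_classical all_reals all_analysis.

Set Implicit Arguments.
Unset Strict Implicit.
Unset Printing Implicit Defensive.

Import Order.TTheory GRing.Theory Num.Theory.
Import numFieldNormedType.Exports.

(** * Finite simplicial graphs *)

Record sgraph := SGraph {
  vertex :> finType;
  adj : rel vertex;
  adj_sym : symmetric adj;
  adj_irrefl : irreflexive adj
}.

Definition connected_sgraph (G : sgraph) : Prop :=
  (0 < #|G|)%N /\ forall u v : G, connect (@adj G) u v.

(** * Groups given by generators and relators *)

(* The letter [(v, true)] stands for v and [(v, false)] for v^-1. *)
Definition word (T : Type) := seq (T * bool).

Definition inv_word (T : Type) (w : word T) : word T :=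
  rev [seq (a.1, ~~ a.2) | a <- w].

Inductive pres_eqv (T : Type) (rel : word T -> Prop) : word T -> word T -> Prop :=
| pres_refl w : pres_eqv rel w w
| pres_sym w1 w2 : pres_eqv rel w1 w2 -> pres_eqv rel w2 w1
| pres_trans w1 w2 w3 :
    pres_eqv rel w1 w2 -> pres_eqv rel w2 w3 -> pres_eqv rel w1 w3
| pres_cancel s1 s2 v b :
    pres_eqv rel (s1 ++ [:: (v, b); (v, ~~ b)] ++ s2) (s1 ++ s2)
| pres_relator s1 s2 r : rel r -> pres_eqv rel (s1 ++ r ++ s2) (s1 ++ s2).

Section PresEqv.
Variables (T : Type) (rel : word T -> Prop).
Local Notation eqv := (pres_eqv rel).

Lemma pres_eqv_ctx u v w1 w2 : eqv w1 w2 -> eqv (u ++ w1 ++ v) (u ++ w2 ++ v).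
Proof.
elim=> {w1 w2}.
- by move=> w; exact: pres_refl.
- by move=> w1 w2 _; exact: pres_sym.
- by move=> w1 w2 w3 _ h12 _; exact: pres_trans.
- move=> s1 s2 x b; have := pres_cancel rel (u ++ s1) (s2 ++ v) x b.
  by rewrite -!catA.
- move=> s1 s2 r hr; have := pres_relator (u ++ s1) (s2 ++ v) hr.
  by rewrite -!catA.
Qed.

Lemma pres_eqv_cat u1 u2 w1 w2 :
  eqv u1 u2 -> eqv w1 w2 -> eqv (u1 ++ w1) (u2 ++ w2).
Proof.
move=> hu hw; apply: (@pres_trans _ _ _ (u2 ++ w1)).
  exact: (pres_eqv_ctx [::] w1 hu).
by have := pres_eqv_ctx u2 [::] hw; rewrite !cats0.
Qed.

Lemma inv_wordK : involutive (@inv_word T).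
Proof.
move=> w; rewrite /inv_word map_rev revK -map_comp -[RHS]map_id.
by apply: eq_map => -[x b] /=; rewrite negbK.
Qed.

Lemma inv_word_cat (w1 w2 : word T) :
  inv_word (w1 ++ w2) = inv_word w2 ++ inv_word w1.
Proof. by rewrite /inv_word map_cat rev_cat. Qed.

Lemma pres_eqv_mulV w : eqv (w ++ inv_word w) [::].
Proof.
elim: w => [|[x b] w ih]; first exact: pres_refl.
rewrite -cat1s inv_word_cat -catA (catA w).
apply: (pres_trans (pres_eqv_ctx [:: (x, b)] (inv_word [:: (x, b)]) ih)).
exact: (pres_cancel rel [::] [::] x b).
Qed.

Lemma pres_eqv_Vmul w : eqv (inv_word w ++ w) [::].
Proof. by have := pres_eqv_mulV (inv_word w); rewrite inv_wordK. Qed.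

Lemma pres_eqv_inv w1 w2 : eqv w1 w2 -> eqv (inv_word w1) (inv_word w2).
Proof.
move=> h; have h1 := pres_eqv_ctx (inv_word w1) (inv_word w2) h.
have h2 := pres_eqv_cat (pres_eqv_Vmul w1) (pres_refl rel (inv_word w2)).
have h3 := pres_eqv_cat (pres_refl rel (inv_word w1)) (pres_eqv_mulV w2).
rewrite cats0 in h3; rewrite /= -catA in h2.
exact: pres_trans (pres_sym h3) (pres_trans (pres_sym h1) h2).
Qed.

End PresEqv.

Section PresentedGroup.
Variables (T : choiceType) (rel : word T -> Prop).

Definition pres_eqvb (w1 w2 : word T) : bool := `[< pres_eqv rel w1 w2 >].

Lemma pres_eqvb_refl : reflexive pres_eqvb.
Proof. by move=> w; apply/asboolP; exact: pres_refl. Qed.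

Lemma pres_eqvb_sym : symmetric pres_eqvb.
Proof. by move=> w1 w2; apply/asboolP/asboolP; exact: pres_sym. Qed.

Lemma pres_eqvb_trans : transitive pres_eqvb.
Proof.
by move=> w2 w1 w3 /asboolP h12 /asboolP h23; apply/asboolP; exact: pres_trans h23.
Qed.

Canonical pres_equiv :=
  EquivRel pres_eqvb pres_eqvb_refl pres_eqvb_sym pres_eqvb_trans.

Local Open Scope quotient_scope.

Definition pres_group := {eq_quot pres_equiv}.
HB.instance Definition _ := Choice.on pres_group.
HB.instance Definition _ := EqQuotient.on pres_group.

Definition class_of (w : word T) : pres_group := \pi_pres_group w.

Lemma class_ofP w1 w2 : class_of w1 = class_of w2 <-> pres_eqv rel w1 w2.
Proof. by split=> [/eqmodP/asboolP|h]; last exact/eqmodP/asboolP. Qed.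

Lemma class_of_repr (x : pres_group) : class_of (repr x) = x.
Proof. exact: reprK. Qed.

Definition pres_one : pres_group := class_of [::].
Definition pres_mul (x y : pres_group) : pres_group :=
  class_of (repr x ++ repr y).
Definition pres_inv (x : pres_group) : pres_group :=
  class_of (inv_word (repr x)).

Lemma pres_mul_class w1 w2 :
  pres_mul (class_of w1) (class_of w2) = class_of (w1 ++ w2).
Proof. by apply/class_ofP/pres_eqv_cat; apply/class_ofP/class_of_repr. Qed.

Lemma pres_inv_class w : pres_inv (class_of w) = class_of (inv_word w).
Proof. by apply/class_ofP/pres_eqv_inv/class_ofP/class_of_repr. Qed.

Lemma pres_mulA : associative pres_mul.
Proof.
move=> x y z; rewrite -(class_of_repr x) -(class_of_repr y) -(class_of_repr z).
by rewrite !pres_mul_class catA.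
Qed.

Lemma pres_mul1 : left_id pres_one pres_mul.
Proof. by move=> x; rewrite -(class_of_repr x) pres_mul_class. Qed.

Lemma pres_mulr1 : right_id pres_one pres_mul.
Proof. by move=> x; rewrite -(class_of_repr x) pres_mul_class cats0. Qed.

Lemma pres_mulV : left_inverse pres_one pres_inv pres_mul.
Proof.
move=> x; rewrite -(class_of_repr x) pres_inv_class pres_mul_class.
exact/class_ofP/pres_eqv_Vmul.
Qed.

Lemma pres_mulrV : right_inverse pres_one pres_inv pres_mul.
Proof.
move=> x; rewrite -(class_of_repr x) pres_inv_class pres_mul_class.
exact/class_ofP/pres_eqv_mulV.
Qed.

HB.instance Definition _ := isGroup.Build pres_group
  pres_mulA pres_mul1 pres_mulr1 pres_mulV pres_mulrV.

End PresentedGroup.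

(** * Right-angled Artin groups *)

Local Open Scope group_scope.

(* The relators are the commutators [u, v] = u^-1 v^-1 u v of adjacent vertices. *)
Definition raag_relator (G : sgraph) (w : word G) : Prop :=
  exists u v : G, adj u v /\
    w = [:: (u, false); (v, false); (u, true); (v, true)].

Definition raag (G : sgraph) := pres_group (@raag_relator G).
HB.instance Definition _ (G : sgraph) := Group.on (raag G).

Definition gen (G : sgraph) (v : G) : raag G :=
  class_of (@raag_relator G) [:: (v, true)].

Definition expgz (A : groupType) (x : A) (l : int) : A :=
  match l with Posz n => x ^+ n | Negz n => x ^- n.+1 end.

Definition syllable (G : sgraph) (x : raag G) : Prop :=
  exists (v : G) (l : int), l <> 0%R /\ x = expgz (gen v) l.

Definition syllable_product (G : sgraph) (g : raag G) (n : nat) : Prop :=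
  exists s : seq (raag G),
    [/\ size s = n, {in s, forall x, syllable x} & g = \prod_(x <- s) x].

Lemma syllable_product_exists (G : sgraph) (g : raag G) :
  exists n, `[< syllable_product g n >].
Proof.
suff h (w : word G) : exists n, syllable_product (class_of (@raag_relator G) w) n.
  by have [n hn] := h (repr g); exists n; apply/asboolP; rewrite class_of_repr in hn.
elim: w => [|[v b] w [n [s [hs hsyl hw]]]].
  by exists 0%N, [::]; split=> //; rewrite big_nil.
pose x : raag G := class_of (@raag_relator G) [:: (v, b)].
exists n.+1, (x :: s); split; first by rewrite /= hs.
- move=> y; rewrite inE => /orP[/eqP ->|]; last exact: hsyl.
  exists v; case: b @x => x; first by exists 1%R.
  exists (Negz 0); split=> //; rewrite /= expg1.
  by apply/esym; exact: pres_inv_class.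
- by rewrite big_cons -hw; apply/esym; exact: pres_mul_class.
Qed.

Definition syllable_length (G : sgraph) (g : raag G) : nat :=
  ex_minn (syllable_product_exists g).

(** * The extension graph *)

Definition is_ext_vertex (G : sgraph) (x : raag G) : bool :=
  `[< exists (v : G) (h : raag G), x = gen v ^ h >].

Definition ext_vertex (G : sgraph) := {x : raag G | is_ext_vertex x}.

Definition ext_adj (G : sgraph) : rel (ext_vertex G) :=
  fun x y => (x != y) && (val x * val y == val y * val x).

Lemma ext_actP (G : sgraph) (x : ext_vertex G) (g : raag G) :
  is_ext_vertex (val x ^ g).
Proof.
case: x => x /= /asboolP[v [h ->]]; apply/asboolP.
by exists v, (h * g); rewrite conjgM.
Qed.

Definition ext_act (G : sgraph) (x : ext_vertex G) (g : raag G) : ext_vertex G :=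
  exist _ (val x ^ g) (ext_actP x g).

(** * Distances and translation lengths *)

Local Open Scope ring_scope.
Local Open Scope classical_set_scope.

(* The edge metric; it is [+oo] between distinct components. *)
Definition graph_dist (R : realType) (X : eqType) (e : rel X) (x y : X) : \bar R :=
  ereal_inf [set (size p)%:R%:E | p in [set p : seq X | path e x p /\ last x p = y]].

Definition ext_dist (R : realType) (G : sgraph) (x y : ext_vertex G) : \bar R :=
  graph_dist R (@ext_adj G) x y.

(* [l] is the limit of d(x, x^(g^n)) / n, whatever the base vertex [x]. *)
Definition is_asymptotic_translation_length
    (R : realType) (G : sgraph) (g : raag G) (l : R) : Prop :=
  forall x : ext_vertex G,
    (fun n : nat => (ext_dist R x (ext_act x (g ^+ n)%g) * (n%:R^-1)%:E)%E)
      @ \oo --> l%:E.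

(* Main.v *)
(* Take the cycle w_0, ..., w_{3k} together with three hubs h_0, h_1, h_2, where
   w_i is joined to h_{i mod 3} for i < 3k, and let g = h_2 h_1 h_0.

   Upper bound: going once around the cycle while multiplying by the adjacent
   hub at each w_i with i < 3k gives a path of length 3k + 1 from w_{3k} to its
   conjugate by g^k.

   Lower bound: the stars of the hubs are disjoint, so killing all other vertices
   maps the star subgroup of each vertex v into a cyclic subgroup of the free
   group F on the hubs.  A path in the extension graph from w_{3k} to its
   conjugate by g^n then yields a walk in the finite graph which meets the stars of
   h_0, h_1, h_2, h_0, ... in this order, 3n times in all.  A step of the walk
   that reaches the next expected hub can only go from w_i to w_{i+1}, so at most
   3k such steps are consecutive: the walk has length at least 3n + n/k - O(1).

   To get the walk one needs that commuting conjugates v^g, w^g' have v, w equal or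
   adjacent, and that the cosets of cyclic subgroups of F attached to them meet.
   If not, when v and w are not hubs, the group acts on F x F_2 x F_2 in such a way
   that v and w act on the fibres through a Heisenberg group, v by f -> f + 1 over
   one coset and w by z -> z + f over the other; the two conjugates then do not
   commute on the fibre over the identity.  The case of a hub reduces to
   centralizers in F. *)
Require Import Defs.
From mathcomp Require Import all_boot all_order all_algebra.
From mathcomp Require Import all_classical all_reals all_analysis.
From mathcomp Require Import zify ring.

Set Implicit Arguments.
Unset Strict Implicit.
Unset Printing Implicit Defensive.

(** * Words in a right-angled Artin group *)

Section RaagWords.
Variable G : sgraph.
Local Open Scope group_scope.
Local Notation cls := (class_of (@raag_relator G)).

Lemma cls_mul (u w : word G) : (cls u : raag G) * cls w = cls (u ++ w).
Proof. exact: pres_mul_class. Qed.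

Lemma cls_inv (w : word G) : (cls w : raag G)^-1 = cls (inv_word w).
Proof. exact: pres_inv_class. Qed.

Lemma cls_repr (g : raag G) : cls (repr g) = g.
Proof. exact: class_of_repr. Qed.

Lemma cls_conj (v : G) (u : word G) :
  gen v ^ cls u = cls (inv_word u ++ (v, true) :: u).
Proof. by rewrite /conjg cls_inv (cls_mul [:: _]) cls_mul. Qed.

Lemma gen_commute (u v : G) : adj u v -> commute (gen u) (gen v).
Proof.
move=> uv; rewrite /commute /gen !cls_mul; apply/class_ofP; apply: pres_sym.
apply: (@pres_trans _ _ _ ([:: (v, true); (u, true)] ++
    [:: (u, false); (v, false); (u, true); (v, true)] ++ [::])).
  have := @pres_relator _ (@raag_relator G) [:: (v, true); (u, true)] [::].
  by move=> h; apply: pres_sym; apply: h; exists u, v.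
apply: (pres_trans (pres_cancel _ [:: (v, true)] _ u true)).
exact: (pres_cancel _ [::] _ v true).
Qed.

(** The presentation acts on the right of the set [ok] as soon as each letter preserves it, inverse
    letters cancel and adjacent generators commute there. *)
Lemma foldl_pres_eqv (X : Type) (ok : X -> Prop) (step : X -> G * bool -> X) :
    (forall s l, ok s -> ok (step s l)) ->
    (forall s x b, ok s -> step (step s (x, b)) (x, ~~ b) = s) ->
    (forall s x y, ok s -> adj x y ->
      step (step s (x, true)) (y, true) = step (step s (y, true)) (x, true)) ->
  forall w1 w2, pres_eqv (@raag_relator G) w1 w2 ->
  forall s, ok s -> foldl step s w1 = foldl step s w2.
Proof.
move=> okS stepV stepC.
have okF w s : ok s -> ok (foldl step s w).
  by elim: w s => //= l w IH s oks; apply/IH/okS.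
move=> w1 w2; elim=> {w1 w2}.
- by [].
- by move=> w1 w2 _ IH s oks; rewrite IH.
- by move=> w1 w2 w3 _ IH1 _ IH2 s oks; rewrite IH1 // IH2.
- by move=> s1 s2 x b s oks; rewrite !foldl_cat /= stepV //; exact: okF.
- move=> s1 s2 r [u [v [uv ->]]] s oks; rewrite !foldl_cat /=.
  congr foldl; set s' := foldl _ _ _; have oks' : ok s' by apply: okF.
  (* Swapping the two positive letters turns the relator into u^-1 v^-1 v u, which cancels. *)
  rewrite stepC; [|exact/okS/okS|by []].
  by rewrite (stepV _ v false) ?(stepV _ u false) //; exact: okS.
Qed.

End RaagWords.

(** * The retraction onto the free group on the hubs *)

(* The stars of the elements of [S], the hubs, are pairwise disjoint; [ell v] is
   the hub whose star contains [v], and is not a hub if there is none. *)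
Section Hubs.
Variables (G : sgraph) (S : {pred G}) (ell : G -> G).
Hypothesis ell_hub : {in S, forall s, ell s = s}.
Hypothesis ell_adj : forall s v, s \in S -> adj s v -> ell v = s.
Hypothesis ell_star : forall v, ell v \in S -> v = ell v \/ adj (ell v) v.
Local Open Scope group_scope.
Local Notation cls := (class_of (@raag_relator G)).

Definition linv (l : G * bool) : G * bool := (l.1, ~~ l.2).

Lemma linvK : involutive linv.
Proof. by move=> [x b]; rewrite /linv /= negbK. Qed.

(** Right multiplication in F(S) by the image of a letter: the top of the stack is the last letter
    of the word, and letters outside [S] are killed. *)
Definition push (t : word G) (l : G * bool) : word G :=
  if l.1 \in S then
    if t is l' :: t' then if l' == linv l then t' else l :: t else [:: l]
  else t.

Definition reduced (t : word G) : bool :=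
  sorted (fun l l' => l' != linv l) t && all (fun l => l.1 \in S) t.

Definition run : word G -> word G -> word G := foldl push.

Lemma run_rcons t w l : run t (rcons w l) = push (run t w) l.
Proof. exact: foldl_rcons. Qed.

Lemma run_cat t w1 w2 : run t (w1 ++ w2) = run (run t w1) w2.
Proof. exact: foldl_cat. Qed.

Lemma push_reduced t l : reduced t -> reduced (push t l).
Proof.
rewrite /reduced /push; case: ifP => // lS; case: t => [|l' t] /=; first by rewrite lS.
case: eqP => [_|/eqP ne] /=; last by rewrite lS ne.
by case/and3P=> /path_sorted -> _ ->.
Qed.

Lemma run_reduced w t : reduced t -> reduced (run t w).
Proof. by elim: w t => //= l w IH t tr; apply/IH/push_reduced. Qed.

Lemma pushK t l : reduced t -> push (push t l) (linv l) = t.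
Proof.
rewrite /reduced /push /=; case lS: (l.1 \in S) => //; case: t => [|l' t] /=.
  by rewrite linvK eqxx.
case: eqP => [->|ne] /=; last by rewrite linvK eqxx.
by case: t => [|l'' t] //=; rewrite linvK; case: eqP => //= ->; rewrite eqxx.
Qed.

Lemma hub_nadj x y : x \in S -> y \in S -> adj x y = false.
Proof.
move=> xS yS; apply/negP => xy; move: (xy).
by rewrite -(ell_hub yS) (ell_adj xS xy) adj_irrefl.
Qed.

Lemma pushC t x y : adj x y -> push (push t (x, true)) (y, true) =
  push (push t (y, true)) (x, true).
Proof.
move=> xy; rewrite /push /=; case xS: (x \in S); case yS: (y \in S) => //.
by rewrite hub_nadj in xy.
Qed.

Lemma run_pres_eqv w1 w2 t :
  pres_eqv (@raag_relator G) w1 w2 -> reduced t -> run t w1 = run t w2.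
Proof.
move=> e tr; apply: (@foldl_pres_eqv _ _ reduced) e _ tr.
- by move=> s l; exact: push_reduced.
- by move=> s x b; exact: (@pushK _ (x, b)).
- by move=> s x y _; exact: pushC.
Qed.

(** On reduced [t] this is a normal form for the coset t<x> in F(S), since the head of the stack is
    the end of the word. For [x] not a hub, <x> is trivial and nothing is removed. *)
Fixpoint strip (x : G) (t : word G) : word G :=
  if t is l :: t' then if l.1 == x then strip x t' else t else [::].

Lemma strip_nil x t : (strip x t == [::]) = all (fun l => l.1 == x) t.
Proof. by elim: t => //= l t IH; case: ifP => //=. Qed.

Lemma strip_id x t : strip x (strip x t) = strip x t.
Proof. by elim: t => //= l t IH; case: ifP => //= ->. Qed.

Lemma strip_push x t b : strip x (push t (x, b)) = strip x t.
Proof.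
rewrite /push; case: ifP => // xS; case: t => [|l t] /=; first by rewrite eqxx.
by case: eqP => [->|_] /=; rewrite eqxx.
Qed.

Lemma strip_run x t w :
  all (fun l => l.1 == x) w -> strip x (run t w) = strip x t.
Proof.
by elim: w t => //= -[y b] w IH t /andP[/eqP /= -> h]; rewrite IH // strip_push.
Qed.

Lemma stripP x t : exists2 p, all (fun l => l.1 == x) p & t = p ++ strip x t.
Proof.
elim: t => [|l t [p hp e]]; first by exists [::].
rewrite /=; case: ifP => lx; last by exists [::].
by exists (l :: p); rewrite /= ?lx // -e.
Qed.

Lemma strip_reduced x t : reduced t -> reduced (strip x t).
Proof.
elim: t => //= l t IH; case: ifP => // _ h; apply: IH.
by move: h; rewrite /reduced /= => /and3P[/path_sorted -> _ ->].
Qed.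

(* The action of the group on the right of the reduced words of F(S), read
   as stacks: the last letter of the group element comes first. *)
Definition ract (t : word G) (g : raag G) : word G := run t (repr g).
Definition nf (g : raag G) : word G := ract [::] g.

Lemma ract_cls t w : reduced t -> ract t (cls w) = run t w.
Proof. by move=> tr; apply: run_pres_eqv => //; apply/class_ofP; exact: cls_repr. Qed.

Lemma ract_reduced t g : reduced t -> reduced (ract t g).
Proof. exact: run_reduced. Qed.

Lemma ractM t g h : reduced t -> ract t (g * h) = ract (ract t g) h.
Proof.
move=> tr; rewrite -{1}(cls_repr g) -{1}(cls_repr h) cls_mul ract_cls //.
exact: foldl_cat.
Qed.

Lemma ract1 t : reduced t -> ract t 1 = t.
Proof. by move=> tr; apply: (ract_cls [::]). Qed.

Lemma nf_reduced g : reduced (nf g).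
Proof. exact: ract_reduced. Qed.

Lemma ractK t g : reduced t -> ract (ract t g) g^-1 = t.
Proof. by move=> tr; rewrite -ractM // mulgV ract1. Qed.

Lemma nfM g h : nf (g * h) = ract (nf g) h.
Proof. exact: ractM. Qed.

Lemma ract_gen t v : reduced t -> ract t (gen v) = push t (v, true).
Proof. by move=> tr; rewrite ract_cls. Qed.

(** Only the image of [w] in F(S) acts; [rev] restores the reading order of its stack. *)
Lemma run_nf t w : reduced t -> run t w = run t (rev (run [::] w)).
Proof.
move=> tr; elim/last_ind: w => [|w l IH] //.
rewrite !run_rcons IH [push (run [::] w) l]/push.
case lS: (l.1 \in S); last by rewrite /push lS.
case E: (run [::] w) => [|l' r] //.
case: eqP => [->|_]; last by rewrite (rev_cons l) run_rcons.
rewrite rev_cons run_rcons.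
by rewrite -[in X in push _ X](linvK l) pushK ?run_reduced.
Qed.

Lemma ract_nf t g : reduced t -> ract t g = run t (rev (nf g)).
Proof. exact: run_nf. Qed.

Lemma strip_ract x t g : reduced t -> strip x (nf g) = [::] ->
  strip x (ract t g) = strip x t.
Proof.
move=> tr /eqP; rewrite strip_nil => h; rewrite ract_nf //; apply: strip_run.
by rewrite all_rev.
Qed.

Lemma run_inv t w : reduced t -> run (run t w) (inv_word w) = t.
Proof. by move=> tr; rewrite -!ract_cls -?cls_inv ?ractK ?ract_reduced. Qed.

Lemma ractV_nf t g : reduced t -> ract t g^-1 = run t (inv_word (rev (nf g))).
Proof.
move=> tr; set w := rev _; have tr' := run_reduced (inv_word w) tr.
by rewrite -{1}[t](@run_inv _ (inv_word w)) // inv_wordK -ract_nf // ractK.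
Qed.

Lemma run_catrev w t : reduced (catrev w t) -> run t w = catrev w t.
Proof.
elim: w t => //= l w IH t h.
have lt : reduced (l :: t).
  move: h; rewrite /reduced catrevE => /andP[].
  rewrite all_cat => + /andP[_ ->]; rewrite andbT.
  elim: (rev w) => //= l' r IHr; case: (r) IHr => [_ /andP[]//|l'' r' IHr /andP[_]].
  exact: IHr.
suff -> : push t l = l :: t by exact: IH.
move: lt; rewrite /reduced /push /= => /and3P[+ -> _].
by case: t {h} => //= l' t /andP[/negbTE->].
Qed.

Lemma push_conj t x w : reduced t -> all (fun l => l.1 == x) w ->
  run t (w ++ (x, true) :: inv_word w) = push t (x, true).
Proof.
elim: w t => [//|[y b] w IH] t tr hw.
have /andP[/eqP yx h] : (y == x) && all (fun l => l.1 == x) w by [].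
rewrite {}yx {hw}.
have -> : ((x, b) :: w) ++ (x, true) :: inv_word ((x, b) :: w) =
    [:: (x, b)] ++ (w ++ (x, true) :: inv_word w) ++ [:: (x, ~~ b)].
  by rewrite -[_ :: w]cat1s inv_word_cat -!catA.
rewrite run_cat run_cat IH ?push_reduced //=; case: b => /=; first exact: (@pushK _ (x, true)) (push_reduced _ _).
by rewrite (@pushK _ (x, false)).
Qed.

(* After cancelling the powers of [a] at its end, [h = h' a^j] and the
   word [h' a h'^-1] is already reduced. *)
Lemma nf_conj_gen (h : raag G) (a b : G) : a \in S ->
  strip b (nf (h * gen a * h^-1)) = [::] -> a = b /\ strip a (nf h) = [::].
Proof.
move=> aS; have [p hp er] := stripP a (nf h).
set r' := strip a (nf h) in er *.
have r'r : reduced r' by apply/strip_reduced/nf_reduced.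
have hd l t : r' = l :: t -> l.1 <> a.
  move=> e; have := strip_id a (nf h); rewrite -/r' e /=.
  case: eqP => // _ e' _; have [q _ /(congr1 size)] := stripP a t.
  by rewrite e' size_cat /= => /eqP; rewrite addnS eqn_leq ltnNge leq_addl andbF.
have -> : nf (h * gen a * h^-1) = [seq linv l | l <- rev r'] ++ (a, true) :: r'.
  rewrite !nfM ractV_nf ?ract_reduced ?nf_reduced // ract_gen ?nf_reduced //.
  rewrite {1}/nf ract_nf // er rev_cat inv_word_cat.
  set p' := rev p; set q := rev r'.
  have pE : run (push (run (run [::] q) p') (a, true)) (inv_word p') =
      push (run [::] q) (a, true).
    by rewrite -[RHS](@push_conj _ a p') ?all_rev ?run_reduced // run_cat.
  rewrite !run_cat pE.
  have qE : run [::] q = r' by rewrite run_catrev /q ?catrevE ?revK ?cats0.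
  rewrite qE.
  have -> : push r' (a, true) = (a, true) :: r'.
    rewrite /push aS; case: (r') hd => //= l t hd; case: eqP => // e.
    by case: (hd l t erefl); rewrite e.
  have -> : inv_word q = [seq linv l | l <- r'] by rewrite /inv_word /q map_rev revK.
  rewrite run_catrev catrevE -map_rev ?cats0 //.
  have /andP[r's r'S] := r'r.
  rewrite /reduced all_cat all_map /= aS r'S andbT; apply/andP; split; last first.
    by rewrite andbT all_rev; exact: r'S.
  case E: r' r's hd => [|l t] // lt hd; rewrite rev_cons map_rcons.
  have sE s y : sorted (fun l l' => l' != linv l) (rcons s y ++ (a, true) :: l :: t) =
      sorted (fun l l' => l' != linv l) (rcons s y) &&
      path (fun l l' => l' != linv l) y ((a, true) :: l :: t).
    by case: s => //= z s; rewrite cat_path last_rcons.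
  have la := hd _ _ erefl.
  rewrite sE -map_rcons -rev_cons sorted_map rev_sorted /= linvK; apply/and4P; split.
  - rewrite -[path _ _ _]/(sorted _ (l :: t)); apply: sub_sorted lt => u v /=.
    by rewrite linvK eq_sym.
  - by apply/eqP => e; rewrite -e in la.
  - by apply/eqP => e; rewrite e in la.
  - by [].
(* All letters of the reduced word are [b]. The middle one gives [a = b]; then [r'], whose head is
   not [a], must be empty. *)
move/eqP; rewrite strip_nil all_cat /= => /and3P[_ /eqP <- h2]; split=> //.
case E: r' h2 => [|l t] //= /andP[/eqP la _]; by case: (hd _ _ E).
Qed.

(** * Heisenberg actions over the reduced words *)

Section HeisenbergAction.
Variables (v w : G) (pv pw : pred (word G)).
Hypothesis (vS : v \notin S) (wS : w \notin S).
Hypothesis pvE : forall t b, pv (push t (ell v, b)) = pv t.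
Hypothesis pwE : forall t b, pw (push t (ell w, b)) = pw t.
Hypothesis disj : v = w \/ adj v w -> forall t, reduced t -> pv t -> pw t -> False.

Definition hstep (s : word G * bool * bool) (l : G * bool) :=
  (push s.1.1 l, s.1.2 (+) ((l.1 == v) && pv s.1.1),
   s.2 (+) [&& l.1 == w, pw s.1.1 & s.1.2]).

Lemma push_id t l : l.1 \notin S -> push t l = t.
Proof. by rewrite /push => /negbTE ->. Qed.

Lemma hubF x y : x \in S -> y \notin S -> (x == y) = false.
Proof. by move=> xS; apply: contraNF => /eqP <-. Qed.

Lemma hstep_hub t f z x b : x \in S -> hstep (t, f, z) (x, b) = (push t (x, b), f, z).
Proof. by move=> xS; rewrite /hstep /= !(hubF xS) //= !addbF. Qed.

Lemma hstepK s x b : reduced s.1.1 -> hstep (hstep s (x, b)) (x, ~~ b) = s.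
Proof.
case: s => [[t f] z] /= tr; have [xS|xS] := boolP (x \in S).
  by rewrite !hstep_hub // (@pushK _ (x, b)).
rewrite /hstep /= !push_id //; have [xv|_] := eqVneq x v; last first.
  by rewrite /= !addbF addbK.
have [xw|_] := eqVneq x w; last by rewrite /= !addbF addbK.
(* A letter and its inverse act alike on the fibre, so the action there must be an involution; this
   would fail for [v = w] with both changes over the same word. *)
have h := disj (or_introl (etrans (esym xv) xw)) tr.
rewrite /=; case: (pv t) h; case: (pw t) => //= h; first by case: h.
  all: by case: f; case: z.
Qed.

(** A hub adjacent to [v] is [ell v], which preserves [pv], and likewise for [w]. If [v] and [w] are
    adjacent, [disj] keeps them from acting over the same word. *)
Lemma hstepC s x y : reduced s.1.1 -> adj x y ->
  hstep (hstep s (x, true)) (y, true) = hstep (hstep s (y, true)) (x, true).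
Proof.
have hubC t f z u u' : u \in S -> u' \notin S -> adj u u' ->
    hstep (hstep (t, f, z) (u, true)) (u', true) =
    hstep (hstep (t, f, z) (u', true)) (u, true).
  move=> uS u'S uu'; rewrite [hstep _ (u', true) in RHS]/hstep !(hstep_hub _ _ _ _ uS).
  rewrite /hstep /= !(@push_id _ (u', true)) //; congr (_, _ (+) _, _ (+) _).
    by case: eqP => // u'v; rewrite -(ell_adj uS uu') u'v pvE.
  by case: eqP => // u'w; rewrite -(ell_adj uS uu') u'w pwE.
case: s => [[t f] z] /= tr xy.
have [xS|xS] := boolP (x \in S); have [yS|yS] := boolP (y \in S).
- by rewrite hub_nadj in xy.
- exact: hubC.
- by apply/esym/hubC => //; rewrite adj_sym.
rewrite /hstep /= !push_id //; congr (_, _, _); first by rewrite addbAC.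
have h u u' : adj u u' -> [&& u == v, u' == w, pv t & pw t] = false.
  move=> uu'; apply/negP => /and4P[/eqP uv /eqP u'w]; apply: disj => //.
  by right; rewrite -uv -u'w.
have := h _ _ xy; have := h y x; rewrite adj_sym => /(_ xy).
by case: (x == v); case: (x == w); case: (y == v); case: (y == w); case: (pv t);
  case: (pw t) => //= _ _; case: f; case: z.
Qed.

Lemma hstep_pres_eqv w1 w2 t f z :
    pres_eqv (@raag_relator G) w1 w2 -> reduced t ->
  foldl hstep (t, f, z) w1 = foldl hstep (t, f, z) w2.
Proof.
move=> e tr; apply: (@foldl_pres_eqv _ _ (fun s => reduced s.1.1)) e _ _ => //.
- by move=> s l; exact: push_reduced.
- by move=> s x b; exact: hstepK.
- by move=> s x y; exact: hstepC.
Qed.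

(* Over the action on reduced words, a word acts on the pair [(f, z)] by an
   element of the Heisenberg group over the field with two elements. *)
Lemma hstep_fiber u t : exists a m c, forall f z,
  foldl hstep (t, f, z) u = (run t u, f (+) a, z (+) (m && f) (+) c).
Proof.
elim: u t => [|l u IH] t.
  by exists false, false, false => f z; rewrite /= !addbF.
have [a [m [c h]]] := IH (push t l).
exists (((l.1 == v) && pv t) (+) a), (m (+) ((l.1 == w) && pw t)),
  ((m && ((l.1 == v) && pv t)) (+) c) => f z /=.
rewrite {2}/hstep /= h; congr (_, _, _); first by rewrite addbA.
by case: (_ == w); case: (_ == v); case: (pv t); case: (pw t); case: m {h};
  case: f; case: z; case: c.
Qed.

(** The conjugate goes by u^-1 to another fibre, lets [v] act there, and returns; the shifts of [f]
    caused by u^-1 and [u] cancel. *)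
Lemma hstep_conj_toggle u t f z : reduced t ->
  (foldl hstep (t, f, z) (inv_word u ++ (v, true) :: u)).1 =
  (t, f (+) pv (run t (inv_word u))).
Proof.
move=> tr; set t1 := run _ _.
have [a [m [c h]]] := hstep_fiber (inv_word u) t.
have [a' [m' [c' h']]] := hstep_fiber u t1.
have := hstep_pres_eqv f z (pres_eqv_Vmul (@raag_relator G) u) tr.
rewrite !foldl_cat h -/t1 h' /= => -[tt' aa' _].
rewrite {2}/hstep /= push_id // eqxx h' /= tt' -[in RHS]aa'; congr (_, _).
by case: f {aa'}; case: a {h}; case: a' {h'}; case: (pv t1).
Qed.

(** Conjugation alters a Heisenberg element only by a central one, here the constant [m] added to
    [z]. The same holds for [w] in [hstep_conj_r]. *)
Lemma hstep_conj_l u t : reduced t -> pv (run t (inv_word u)) ->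
    (v = w -> ~~ pw (run t (inv_word u))) ->
  exists m, forall f z,
    foldl hstep (t, f, z) (inv_word u ++ (v, true) :: u) = (t, ~~ f, z (+) m).
Proof.
move=> tr pvt pwt; set t1 := run _ _ in pvt pwt.
have [a [m [c h]]] := hstep_fiber (inv_word u) t.
exists m => f z; rewrite foldl_cat h -/t1 /= {2}/hstep /= push_id // eqxx pvt /=.
have -> : (v == w) && (pw t1 && (f (+) a)) = false.
  by case: eqP => //= /pwt/negbTE ->.
have := @hstep_pres_eqv (inv_word u ++ u) [::] t (~~ f) (z (+) m).
rewrite foldl_cat h -/t1 /= => <- //; last exact: pres_eqv_Vmul.
congr (foldl _ (_, _, _)); first by case: f; case: a {h}.
by case: f; case: z; case: m {h}; case: c.
Qed.

Lemma hstep_conj_r u t : reduced t -> pw (run t (inv_word u)) ->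
    (v = w -> ~~ pv (run t (inv_word u))) ->
  exists a, forall f z,
    foldl hstep (t, f, z) (inv_word u ++ (w, true) :: u) = (t, f, z (+) f (+) a).
Proof.
move=> tr pwt pvt; set t1 := run _ _ in pvt pwt.
have [a [m [c h]]] := hstep_fiber (inv_word u) t.
exists a => f z; rewrite foldl_cat h -/t1 /= {2}/hstep /= push_id // eqxx pwt /=.
have -> : (w == v) && pv t1 = false.
  by case: eqP => //= /esym /pvt/negbTE ->.
have := @hstep_pres_eqv (inv_word u ++ u) [::] t f (z (+) f (+) a).
rewrite foldl_cat h -/t1 /= => <- //; last exact: pres_eqv_Vmul.
congr (foldl _ (_, _, _)); first by case: f; case: a {h}.
by case: f; case: z; case: m {h}; case: c; case: a.
Qed.

(** Over [t] the conjugates act as f -> f + 1 and z -> z + f, up to central shifts. Applied to (0,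
    0) in the two orders, they give values of [z] differing by 1. *)
Lemma hstep_not_commute u u' t : reduced t ->
    pv (run t (inv_word u)) -> pw (run t (inv_word u')) ->
  ~ commute (gen v ^ cls u : raag G) (gen w ^ cls u').
Proof.
move=> tr pvt pwt; rewrite /commute !cls_conj !cls_mul => /class_ofP e.
have [m hm] : exists m, forall f z,
    foldl hstep (t, f, z) (inv_word u ++ (v, true) :: u) = (t, ~~ f, z (+) m).
  apply: hstep_conj_l => // vw; apply/negP.
  by apply: disj pvt; [left | exact: run_reduced].
have [a ha] : exists a, forall f z,
    foldl hstep (t, f, z) (inv_word u' ++ (w, true) :: u') = (t, f, z (+) f (+) a).
  apply: hstep_conj_r => // vw; apply/negP => pvt'.
  by apply: disj pvt' pwt; [left | exact: run_reduced].
set A := inv_word u ++ _ in hm; set B := inv_word u' ++ _ in ha.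
have := @hstep_pres_eqv (A ++ B) (B ++ A) t false false e tr.
rewrite (foldl_cat _ _ A) (foldl_cat _ _ B) hm ha ha hm.
by case: m {hm}; case: a {ha}.
Qed.

End HeisenbergAction.

(* The cosets of the cyclic subgroups of [ell v] and [ell w] in F(S) attached to
   the vertices [v ^ g] and [w ^ g'] of the extension graph intersect. *)
Definition incident (v : G) (g : raag G) (w : G) (g' : raag G) : Prop :=
  exists2 t, reduced t &
    strip (ell v) t = strip (ell v) (nf g^-1) /\
    strip (ell w) t = strip (ell w) (nf g'^-1).

Lemma incident_sym v g w g' : incident v g w g' -> incident w g' v g.
Proof. by case=> t tr [e1 e2]; exists t. Qed.

(** Only the toggling of [f] is used, so [w] takes both roles and [pw] is empty. [B] toggles [f]
    over [nf g']; commuting with [A], it also does so over the image of [nf g'] under [A], which is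
    the claim. *)
Lemma commute_hub_conj v w g g' : v \in S -> w \notin S ->
    commute (gen v ^ g) (gen w ^ g') ->
  strip (ell w) (nf (g' * g^-1 * gen v * (g' * g^-1)^-1)) = [::].
Proof.
move=> vS wS vw; pose u := repr g; pose u' := repr g'.
set A := inv_word u ++ (v, true) :: u; set B := inv_word u' ++ (w, true) :: u'.
have e : pres_eqv (@raag_relator G) (A ++ B) (B ++ A).
  by apply/class_ofP; rewrite -(cls_mul A B) -(cls_mul B A) -!cls_conj !cls_repr.
pose pv t := strip (ell w) t == [::].
have pvE t b : pv (push t (ell w, b)) = pv t by rewrite /pv strip_push.
pose pw : pred (word G) := pred0.
have pwE t b : pw (push t (ell w, b)) = pw t by [].
have disj : w = w \/ adj w w -> forall t, reduced t -> pv t -> pw t -> False by [].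
have hC := @hstep_conj_toggle w w pv pw wS wS pvE pwE disj u'.
have hA := @hstep_fiber w w pv pw A (nf g').
have := @hstep_pres_eqv w w pv pw wS wS pvE pwE disj
  (A ++ B) (B ++ A) (nf g') false false e (nf_reduced _).
have {hC} hC t f z : reduced t -> (foldl (hstep w w pv pw) (t, f, z) B).1 =
  (t, f (+) pv (run t (inv_word u'))) by apply: hC.
case: hA => a [m [c hA]]; rewrite (foldl_cat _ _ A) (foldl_cat _ _ B) hA.
move=> /(congr1 fst); rewrite hC ?run_reduced ?nf_reduced //.
have := hC (nf g') false false (nf_reduced g').
case: (foldl _ _ B) => -[_ f] z /= [-> ->]; rewrite hA /= => -[].
have -> : run (nf g') (inv_word u') = [::] by rewrite run_inv.
have -> : run (run (nf g') A) (inv_word u') =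
    nf (g' * g^-1 * gen v * (g' * g^-1)^-1).
  have -> : g' * g^-1 * gen v * (g' * g^-1)^-1 = g' * gen v ^ g * g'^-1.
    by rewrite /conjg invgM invgK !mulgA.
  rewrite !nfM -(cls_repr g') cls_inv ract_cls ?ract_reduced ?nf_reduced //.
  by rewrite -(cls_repr g) cls_conj ract_cls // ?nf_reduced.
by rewrite /pv eqxx /=; case: a {hA} => //=; case: eqP.
Qed.

Lemma hub_incident v w g g' : v \in S -> v = ell w ->
    strip v (nf (g' * g^-1)) = [::] ->
  (v = w \/ adj v w) /\ incident v g w g'.
Proof.
move=> vS vw h; split.
  have wS : ell w \in S by rewrite -vw.
  by rewrite vw; case: (ell_star wS) => [<-|]; [left|right].
exists (nf g^-1); rewrite ?nf_reduced // -vw (ell_hub vS); split=> //.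
rewrite -(strip_ract (nf_reduced g'^-1) h) -nfM.
by rewrite mulgA mulVg mul1g.
Qed.

Lemma commute_incident v w g g' : commute (gen v ^ g) (gen w ^ g') ->
  (v = w \/ adj v w) /\ incident v g w g'.
Proof.
have hubl v1 w1 g1 g1' : v1 \in S -> w1 \notin S ->
    commute (gen v1 ^ g1) (gen w1 ^ g1') -> (v1 = w1 \/ adj v1 w1) /\ incident v1 g1 w1 g1'.
  by move=> vS wS /(commute_hub_conj vS wS) /(nf_conj_gen vS)[]; exact: hub_incident.
move=> c; have [vS|vS] := boolP (v \in S); have [wS|wS] := boolP (w \in S).
- pose h := g' * g^-1.
  have ch : (gen w ^ h) * gen v * (gen w ^ h)^-1 = gen v.
    apply/(canLR (mulgK _)); apply: (conjg_inj g); rewrite [LHS]conjMg [RHS]conjMg -conjgM mulgVK.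
    exact/esym.
  (* Commuting with [v] makes the image of w^h a power of [v]. A second use of [nf_conj_gen], on
     this conjugate of [w], yields [w = v] and that the image of h^-1 is a power of [v]. *)
  have := @nf_conj_gen (gen w ^ h) v v vS; rewrite ch.
  have -> : strip v (nf (gen v)) = [::] by rewrite /nf ract_gen // /push vS /= eqxx.
  case=> // _; rewrite /conjg mulgA -{2}(invgK h) => /(nf_conj_gen wS)[wv h0].
  have := @hub_incident w v g' g wS; rewrite (ell_hub vS) => /(_ wv).
  rewrite /h invgM invgK in h0; case=> // ad inc; split; last exact: incident_sym.
  by left.
- exact: hubl.
- have [[e|ad] inc] := hubl _ _ _ _ wS vS (esym c); split; try exact: incident_sym.
    by left.
  by right; rewrite adj_sym.
- apply: contrapT => nc.
  (* These are the two cosets. Were the conclusion false, they would be disjoint whenever [v] and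
     [w] are equal or adjacent, as [disj] asks; the action is then tested over the empty word. *)
  pose pv t := strip (ell v) t == strip (ell v) (nf g^-1).
  pose pw t := strip (ell w) t == strip (ell w) (nf g'^-1).
  have pvE t b : pv (push t (ell v, b)) = pv t by rewrite /pv strip_push.
  have pwE t b : pw (push t (ell w, b)) = pw t by rewrite /pw strip_push.
  rewrite -(cls_repr g) -(cls_repr g') in c.
  apply: (@hstep_not_commute v w pv pw vS wS pvE pwE _ _ _ [::]) c => //.
  - move=> ad t tr /eqP tv /eqP tw; apply: nc; split=> //; by exists t.
  - by rewrite /pv -ract_cls // -cls_inv cls_repr.
  - by rewrite /pw -ract_cls // -cls_inv cls_repr.
Qed.

(* The syllables of the reduced word [t], as a sequence of letters. *)
Fixpoint letters (t : word G) : seq G :=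
  if t is l :: t' then
    if ohead (letters t') == Some l.1 then letters t' else l.1 :: letters t'
  else [::].

Lemma letters_strip x t :
  letters t = letters (strip x t) \/ letters t = x :: letters (strip x t).
Proof.
elim: t => [|l t IH]; first by left.
rewrite [strip _ _]/=; have [lx|_] := eqVneq l.1 x; last by left.
by rewrite /= lx; case: IH => -> /=; [case: ifP; [left|right] | rewrite eqxx; right].
Qed.

Lemma letters_strip_subseq x t : subseq (letters (strip x t)) (letters t).
Proof. by case: (letters_strip x t) => ->; rewrite // subseq_cons. Qed.

Lemma subseq_letters_strip x t : subseq (letters t) (x :: letters (strip x t)).
Proof. by case: (letters_strip x t) => ->; rewrite // subseq_cons. Qed.

(** Both cosets contain [t], and stripping removes at most one syllable, namely [ell v] on the side
    of [v]. *)
Lemma incident_letters v g w g' : incident v g w g' ->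
  subseq (letters (strip (ell w) (nf g'^-1)))
         (ell v :: letters (strip (ell v) (nf g^-1))).
Proof.
case=> t _ [<- <-].
exact: subseq_trans (letters_strip_subseq _ _) (subseq_letters_strip _ _).
Qed.

(** The walk follows the vertices [w] in chosen expressions w^g of the path's vertices; each step
    adds at most one syllable, the [ell] of the vertex left. Since the expression of the endpoint is
    arbitrary, the empty path already takes one step. *)
Lemma ext_path_walk (x : ext_vertex G) (p : seq (ext_vertex G)) (v : G) :
    val x = gen v -> path (@ext_adj G) x p ->
  forall w g, val (last x p) = gen w ^ g ->
  exists q, [/\ path (fun a b => (a == b) || adj a b) v q, size q = (size p).+1 &
    subseq (rev (letters (strip (ell w) (nf g^-1)))) (map ell (belast v q))].
Proof.
move=> xv; suff h : path (@ext_adj G) x p -> forall w g, val (last x p) = gen w ^ g ->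
  exists q, [/\ path (fun a b => (a == b) || adj a b) v q, last v q = w,
    size q = (size p).+1 &
    subseq (rev (letters (strip (ell w) (nf g^-1)))) (map ell (belast v q))].
  by move=> xp w g /(h xp)[q [? _ ? ?]]; exists q.
elim/last_ind: p => [_ w g /= xw|p z IH].
  have [vw /incident_letters sub] := @commute_incident v w 1 g
    (ltac:(by rewrite conjg1 -xv -xw)).
  exists [:: w]; split=> //; first by case: vw => /= ->; rewrite ?eqxx ?orbT.
  by rewrite -subseq_rev revK; rewrite invg1 {2}/nf ract1 in sub.
rewrite rcons_path last_rcons => /andP[/IH{}IH /andP[_ /eqP yz]] w g zw.
have /asboolP[u [h yu]] := valP (last x p).
have [q [vq qu sq sub]] := IH _ _ yu.
rewrite zw yu in yz; have [uw /incident_letters sub'] := commute_incident yz.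
exists (rcons q w); rewrite rcons_path vq last_rcons !size_rcons sq qu; split=> //.
  by case: uw => [->|->]; rewrite ?eqxx ?orbT.
rewrite belast_rcons lastI map_rcons qu.
move: sub'; rewrite -subseq_rev rev_cons => /subseq_trans; apply.
by rewrite -!cats1 cat_subseq.
Qed.

(** * Syllable length under the retraction *)

Lemma strip_nfM v g h : strip v (nf g) = [::] -> strip v (nf h) = [::] ->
  strip v (nf (g * h)) = [::].
Proof. by move=> g0 h0; rewrite nfM strip_ract // nf_reduced. Qed.

Lemma strip_nfV v g : strip v (nf g) = [::] -> strip v (nf g^-1) = [::].
Proof.
move=> g0; rewrite -(strip_ract (nf_reduced _) g0) -nfM mulVg.
by rewrite /nf ract1.
Qed.

Lemma syllable_strip x : syllable x -> exists v, strip v (nf x) = [::].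
Proof.
case=> v [l [_ ->]]; exists v.
have pow n : strip v (nf (gen v ^+ n)) = [::].
  elim: n => [|n IH]; first by rewrite expg0 /nf ract1.
  by rewrite expgSr strip_nfM // /nf ract_gen // strip_push.
by case: l => n /=; [|apply: strip_nfV]; exact: pow.
Qed.

(** A syllable maps into one cyclic subgroup of F(S), so multiplying by it adds at most one entry to
    [letters]. *)
Lemma size_letters_prod (s : seq (raag G)) : {in s, forall x, syllable x} ->
  size (letters (nf (\prod_(x <- s) x))) <= size s.
Proof.
suff h t : reduced t -> {in s, forall x, syllable x} ->
    size (letters (ract t (\prod_(x <- s) x))) <= size (letters t) + size s.
  by move=> /(h [::] isT).
elim: s t => [|x s IH] t tr syl; first by rewrite big_nil ract1 // addn0.
have [|v xv] := @syllable_strip x; first by apply: syl; rewrite mem_head.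
rewrite big_cons ractM //; apply: leq_trans (IH _ _ _) _; first exact: ract_reduced.
  by move=> y ys; apply: syl; rewrite inE ys orbT.
rewrite /= addnS -addSn leq_add2r.
apply: leq_trans (size_subseq (subseq_letters_strip v _)) _.
by rewrite strip_ract // ltnS size_subseq // letters_strip_subseq.
Qed.

End Hubs.

(** * The graph and the lower bound *)

Section HubCycle.
Variable N : nat.
Implicit Types i j : 'I_N.+1.

Definition hubcycle_adj (x y : 'I_N.+1 + 'I_3) : bool :=
  match x, y with
  | inl i, inl j => (i != j) &&
      [|| j == i.+1 :> nat, i == j.+1 :> nat, (i == 0 :> nat) && (j == N :> nat)
        | (i == N :> nat) && (j == 0 :> nat)]
  | inl i, inr s => (i < N) && (i %% 3 == s)
  | inr s, inl i => (i < N) && (i %% 3 == s)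
  | inr _, inr _ => false
  end.

Lemma hubcycle_sym : symmetric hubcycle_adj.
Proof.
move=> [i|s] [j|u] //=; rewrite eq_sym; congr (_ && _).
by case: (_ == _); case: (_ == _); case: (_ == _); case: (_ == _);
  case: (_ == _); case: (_ == _).
Qed.

Lemma hubcycle_irrefl : irreflexive hubcycle_adj.
Proof. by move=> [i|s] //=; rewrite eqxx. Qed.

Definition hubcycle : sgraph := SGraph hubcycle_sym hubcycle_irrefl.

Definition hub (n : nat) : hubcycle := inr (inZp n).
Definition rim (n : nat) : hubcycle := inl (inord n).

Definition is_hub : {pred hubcycle} := fun x => if x is inr _ then true else false.

(** The vertex [rim N] lies in no hub's star; it is sent to itself, which is not a hub. *)
Definition nearest_hub (x : hubcycle) : hubcycle :=
  if x is inl i then if i < N then hub i else inl i else x.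

Lemma hub_eq m n : (hub m == hub n) = (m == n %[mod 3]).
Proof. by []. Qed.

Lemma hub_ord (s : 'I_3) : hub s = inr s.
Proof. by congr inr; apply: val_inj; rewrite /= modn_small. Qed.

Lemma nearest_hub_id : {in is_hub, forall s, nearest_hub s = s}.
Proof. by case. Qed.

Lemma nearest_hub_adj s v : s \in is_hub -> adj s v -> nearest_hub v = s.
Proof.
case: s => // s _; case: v => //= i /andP[-> /eqP is_s].
by congr inr; apply: val_inj.
Qed.

Lemma nearest_hub_star v :
  nearest_hub v \in is_hub -> v = nearest_hub v \/ adj (nearest_hub v) v.
Proof.
case: v => [i|s]; last by left.
by rewrite /=; case: ifP => // iN _; right; rewrite /= iN eqxx.
Qed.

Lemma rim_adj n : n < N -> @adj hubcycle (rim n) (rim n.+1).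
Proof.
move=> nN; rewrite /= !inordK ?eqxx ?andbT ?ltnS //; last exact: ltnW.
by apply/eqP => /(congr1 val); rewrite /= !inordK ?ltnS //; [lia | exact: ltnW].
Qed.

Lemma hubcycle_connected : 2 < N -> connected_sgraph hubcycle.
Proof.
move=> N0; have rim0 n : n <= N -> connect (@adj hubcycle) (rim 0) (rim n).
  elim: n => [|n IH] nN; first exact: connect0.
  by apply: connect_trans (IH (ltnW nN)) _; apply/connect1/rim_adj.
have csym : connect_sym (@adj hubcycle) by apply: sym_connect_sym; exact: adj_sym.
split; first by apply/card_gt0P; exists (rim 0).
have to0 v : connect (@adj hubcycle) (rim 0) v.
  case: v => [i|s]; first by rewrite -(inord_val i); apply: rim0; rewrite -ltnS.
  have sN : s < N by apply: leq_trans (ltn_ord s) N0.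
  apply: connect_trans (rim0 _ (ltnW sN)) _; apply: connect1.
  by rewrite /= inordK ?sN ?modn_small //= ltnS ltnW.
by move=> u v; apply: connect_trans (to0 v); rewrite csym.
Qed.

End HubCycle.

(** * Counting the hubs met by a walk *)

Section Bounds.
Variable k : nat.
Hypothesis k_gt1 : 1 < k.
Let N := 3 * k.
Local Notation G := (hubcycle N).
Local Notation hub := (@hub N).
Local Notation hub_nf := (nf (@is_hub N)).

(* The number of further consecutive steps that can each reach the next expected
   hub, [q] being the first of them, if [x] itself reached the hub before [q]. *)
Definition slack (x : G) (q : nat) : nat :=
  match x with
  | inl i => if (i < N) && (q == i.+1 %[mod 3]) then N - i.+1 else N
  | inr s => if q == s.+1 %[mod 3] then 0 else N
  end.

Lemma slack_le x q : slack x q <= N.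
Proof. by case: x => [i|s] /=; case: ifP => // _; rewrite leq_subr. Qed.

(** Between the stars of two consecutive hubs the only edges go from w_i to w_{i+1} with i + 1 < N,
    so the index grows. If [x] did not reach the previous hub, its slack is the full [N]. *)
Lemma slack_step x y q : (x == y) || adj x y -> nearest_hub y = hub q ->
  slack y q.+1 < slack x q.
Proof.
move=> xy yq; have {yq} : match y with
    inl j => (j < N) && (j == q %[mod 3]) | inr s => (s : nat) == q %[mod 3] end.
  move: yq; case: y {xy} => [j|s] /=.
    by case: ifP => //= _ /eqP; rewrite hub_eq.
  by move=> /eqP; rewrite -hub_ord hub_eq.
case: x xy => [i|s]; case: y => [j|u] /=.
- rewrite (inj_eq inl_inj) -!val_eqE /= => xy jq.
  by have := ltn_ord i; have := ltn_ord j; do ![case: ifP]; rewrite /N in xy jq *; lia.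
- by have := ltn_ord i; do ![case: ifP]; rewrite /N; lia.
- by have := ltn_ord j; do ![case: ifP]; rewrite /N; lia.
- by rewrite (inj_eq inr_inj) -!val_eqE /= orbF; do ![case: ifP]; rewrite /N; lia.
Qed.

Lemma walk_hubs p x q M : path (fun a b : G => (a == b) || adj a b) x p ->
    subseq [seq hub i | i <- iota q M] [seq nearest_hub y | y <- p] ->
  M * N.+1 <= N * size p + slack x q.
Proof.
elim: p x q M => [|y p IH] x q [|M] //= /andP[xy yp].
case: eqP => [/esym yq /(IH _ _ _ yp) h|_ /(IH _ _ M.+1 yp) h].
  have := slack_step xy yq; move: h; rewrite mulSn (mulnS N).
  by move: (M * N.+1) (N * _) (slack _ _) (slack _ _) => a b c d; lia.
have := slack_le y q; move: h; rewrite (mulnS N).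
by move: (M.+1 * N.+1) (N * _) (slack _ _) (slack _ _) => a b c d; lia.
Qed.

Definition hub_word (M : nat) : word G := [seq (hub i, false) | i <- iota 0 M].

Definition loop_elt : raag G := (gen (hub 2) * gen (hub 1) * gen (hub 0))%g.

Local Notation cls := (class_of (@raag_relator G)).

(** The cosets in [incident] involve the inverse of the conjugator, which here runs through h_0,
    h_1, h_2, h_0, ... in increasing order. *)
Lemma loop_elt_pow n : ((loop_elt ^+ n)^-1)%g = cls (hub_word (3 * n)).
Proof.
elim: n => [|n IH]; first by rewrite invg1.
have loopV : (loop_elt^-1)%g = cls (hub_word 3).
  rewrite /loop_elt !invgM !cls_inv (cls_mul (inv_word [:: (hub 1, true)])).
  exact: cls_mul.
rewrite expgS invgM IH loopV cls_mul; congr (cls _).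
rewrite /hub_word mulnS addnC iotaD map_cat; congr (_ ++ _) => /=.
congr [:: (_, _); (_, _); (_, _)]; apply/eqP; rewrite hub_eq add0n mulnC.
- by rewrite modnMl.
- by rewrite -[(n * 3).+1]addn1 modnMDl.
- by rewrite -[(n * 3).+2]addn2 modnMDl.
Qed.

Lemma run_hub_word M : run (@is_hub N) [::] (hub_word M) = rev (hub_word M).
Proof.
elim: M => [|M IH] //; rewrite /hub_word -[M.+1]addn1 iotaD map_cat cats1 run_rcons.
rewrite -/(hub_word M) IH rev_rcons /push /=; case E: (rev _) => [|l t] //.
case: eqP => // ll; have : l \in rev (hub_word M) by rewrite E mem_head.
by rewrite mem_rev => /mapP[i _]; rewrite ll.
Qed.

Lemma letters_hub_word M : letters (rev (hub_word M)) = rev [seq hub i | i <- iota 0 M].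
Proof.
elim: M => [|M IH] //.
rewrite /hub_word -[M.+1]addn1 iotaD !map_cat !cats1 !rev_rcons /= -/(hub_word M) IH.
rewrite add0n; case: M {IH} => [|M] //.
rewrite -[in iota _ _]addn1 iotaD map_cat cats1 rev_rcons /= add0n.
by case: eqP => // -[] /eqP; rewrite -[_ == _]/(M == M.+1 %[mod 3]); lia.
Qed.

Let ell_hub := @nearest_hub_id N.
Let ell_adj := @nearest_hub_adj N.
Let ell_star := @nearest_hub_star N.

Lemma hub_word_nf n : hub_nf (loop_elt ^+ n)^-1%g = rev (hub_word (3 * n)).
Proof.
rewrite loop_elt_pow /nf (ract_cls ell_hub ell_adj) //; exact: run_hub_word.
Qed.

Lemma size_letters_loop_elt : size (letters (hub_nf loop_elt)) = 3.
Proof.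
rewrite /loop_elt /gen (cls_mul [:: _] [:: _]) (cls_mul _ [:: _]) /nf.
by rewrite (ract_cls ell_hub ell_adj).
Qed.

Lemma loop_elt_syllable_length : syllable_length loop_elt = 3.
Proof.
rewrite /syllable_length; case: ex_minnP => m /asboolP[s [sm syl e]] mmin.
apply/eqP; rewrite eqn_leq mmin /=; last first.
  apply/asboolP; exists [:: gen (hub 2); gen (hub 1); gen (hub 0)]; split=> //.
    move=> x; rewrite !inE => /or3P[] /eqP ->; [exists (hub 2)|exists (hub 1)|exists (hub 0)];
      by exists 1%R; split=> //=; rewrite expg1.
  by rewrite !big_cons big_nil mulg1 mulgA.
(* The image of g in F(S) has three syllables, so no shorter product can equal g. *)
rewrite -size_letters_loop_elt e -sm.
exact: (size_letters_prod ell_hub ell_adj syl).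
Qed.

Lemma strip_hub_word i M : strip (inl i : G) (rev (hub_word M)) = rev (hub_word M).
Proof.
case: M => [|M] //; rewrite /hub_word -[M.+1]addn1 iotaD map_cat cats1 rev_rcons.
by rewrite add0n.
Qed.

Lemma ext_path_loop_lb (x y : ext_vertex G) p n :
    val x = gen (rim N N) -> val y = (gen (rim N N) ^ loop_elt ^+ n)%g ->
    path (@ext_adj G) x p -> last x p = y ->
  n * (3 * k).+1 <= k * (size p).+2.
Proof.
move=> xE yE xp lp; rewrite -lp in yE.
have ellN : nearest_hub (rim N N) = rim N N.
  by rewrite /= inordK ?ltnn.
have [q [wq sq]] := ext_path_walk ell_hub ell_adj ell_star xE xp yE.
rewrite ellN hub_word_nf strip_hub_word letters_hub_word revK => sub.
(* The path lemma lists the vertices left, the count those reached; dropping the start [rim N] is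
   harmless because its [nearest_hub] is not a hub. *)
have {}sub : subseq [seq hub i | i <- iota 0 (3 * n)] [seq nearest_hub y | y <- q].
  have : subseq [seq hub i | i <- iota 0 (3 * n)] [seq nearest_hub y | y <- rim N N :: q].
    rewrite lastI map_rcons -cats1; apply: subseq_trans sub _.
    exact: prefix_subseq.
  by rewrite map_cons ellN; case: (iota _ _) => [|m s] //=; rewrite ?sub0seq.
(* The walk has one step more than the path, and the initial slack is worth at most one further
   step: hence the two extra units. *)
have := walk_hubs wq sub; have := slack_le (rim N N) 0; rewrite sq /N.
move: (slack _ _) => c; nia.
Qed.

End Bounds.

(** * Distances in the extension graph *)

Section ExtensionGraph.
Variable G : sgraph.
Implicit Types x y z : ext_vertex G.
Local Open Scope group_scope.

Definition dist_le x y (n : nat) : Prop :=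
  exists p, [/\ path (@ext_adj G) x p, last x p = y & (size p <= n)%N].

Lemma dist_le_refl x n : dist_le x x n.
Proof. by exists [::]. Qed.

Lemma dist_le_trans y x z m n :
  dist_le x y m -> dist_le y z n -> dist_le x z (m + n)%N.
Proof.
case=> p [xp lp sp] [q [yq lq sq]]; exists (p ++ q).
by rewrite cat_path last_cat size_cat lp xp yq lq leq_add.
Qed.

Lemma ext_adj_sym : symmetric (@ext_adj G).
Proof. by move=> x y; rewrite /ext_adj eq_sym [_ == _ * _]eq_sym. Qed.

Lemma dist_le_sym x y n : dist_le x y n -> dist_le y x n.
Proof.
case=> p [xp lp sp]; elim: p x n xp lp sp => [|z p IH] x n /=.
  by move=> _ -> _; exact: dist_le_refl.
case/andP=> xz zp lp; case: n => // n sp; rewrite -addn1.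
apply: dist_le_trans (IH _ _ zp lp sp) _; exists [:: x].
by rewrite /= ext_adj_sym xz.
Qed.

Lemma commute_dist_le x y : commute (val x) (val y) -> dist_le x y 1.
Proof.
move=> c; have [->|xy] := eqVneq x y; first exact: dist_le_refl.
by exists [:: y]; rewrite /= /ext_adj xy; split=> //; apply/andP; split=> //; exact/eqP.
Qed.

Lemma commute_conj (a b h : raag G) : commute a b -> commute (a ^ h) (b ^ h).
Proof. by rewrite /commute => c; rewrite -[LHS]conjMg -[RHS]conjMg c. Qed.

Lemma ext_actM x (g h : raag G) : ext_act (ext_act x g) h = ext_act x (g * h).
Proof. by apply: val_inj; rewrite /= conjgM. Qed.

Lemma dist_le_act x y n g : dist_le x y n -> dist_le (ext_act x g) (ext_act y g) n.
Proof.
case=> p [xp lp sp]; exists [seq ext_act z g | z <- p].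
rewrite (last_map (fun z => ext_act z g)) size_map lp; split=> //.
rewrite (@path_map _ _ (fun z => ext_act z g)).
apply: sub_path xp => u v /andP[uv /eqP c]; rewrite /= /ext_adj; apply/andP; split.
  by apply: contraNneq uv => /(congr1 val)/conjg_inj e; apply/eqP/val_inj.
by apply/eqP; exact: commute_conj.
Qed.

Lemma ext_act_pow x (g : raag G) m n : dist_le x (ext_act x g) m ->
  dist_le x (ext_act x (g ^+ n)) (n * m)%N.
Proof.
move=> xm; elim: n => [|n IH].
  by exists [::]; split=> //; apply: val_inj; rewrite /= conjg1.
rewrite mulSn expgSr -ext_actM; apply: dist_le_trans xm _.
exact: dist_le_act.
Qed.

Fact ext_gen_subproof (v : G) (g : raag G) : is_ext_vertex (gen v ^ g).
Proof. by apply/asboolP; exists v, g. Qed.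

Definition ext_gen (v : G) (g : raag G) : ext_vertex G :=
  exist _ (gen v ^ g) (ext_gen_subproof v g).

Lemma ext_gen_act v g h : ext_act (ext_gen v g) h = ext_gen v (g * h).
Proof. by apply: val_inj; rewrite /= conjgM. Qed.

Lemma dist_le_adj u v g : adj u v -> dist_le (ext_gen u g) (ext_gen v g) 1.
Proof. by move=> uv; apply/commute_dist_le/commute_conj/gen_commute. Qed.

Lemma dist_le_gen (u v : G) : connect (@adj G) u v ->
  forall g, exists n, dist_le (ext_gen u g) (ext_gen v g) n.
Proof.
case/connectP=> p up -> g; exists (size p).
elim: p u up => [|w p IH] u /=; first by move=> _; exact: dist_le_refl.
case/andP=> uw wp; rewrite -add1n.
exact: dist_le_trans (dist_le_adj _ uw) (IH _ wp).
Qed.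

Lemma ext_connected x y : connected_sgraph G -> exists n, dist_le x y n.
Proof.
case=> _ conn.
suff h u v (g : raag G) : exists n, dist_le (ext_gen u g) (ext_gen v 1) n.
  have /asboolP[u [g xE]] := valP x; have /asboolP[v [h' yE]] := valP y.
  have -> : x = ext_gen u g by exact: val_inj.
  have -> : y = ext_gen v h' by exact: val_inj.
  have [m hm] := h u v g; have [n hn] := h v v h'.
  by exists (m + n)%N; apply: dist_le_trans hm (dist_le_sym hn).
rewrite -(cls_repr g); elim: (repr g) u => [|l w IH] u.
  exact: (dist_le_gen (conn u v)).
have -> : class_of (@raag_relator G) (l :: w) =
    (class_of (@raag_relator G) [:: l] : raag G) * class_of (@raag_relator G) w.
  by rewrite (cls_mul [:: l]).
set a : raag G := class_of _ [:: l]; set b : raag G := class_of _ w.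
have [m hm] := dist_le_gen (conn u l.1) (a * b).
have [n hn] := IH l.1.
exists (m + n)%N; apply: dist_le_trans hm _.
have -> // : ext_gen l.1 (a * b) = ext_gen l.1 b.
apply: val_inj; rewrite /= conjgM; congr (_ ^ _); rewrite /a.
case: (l) => v' [] /=; first by rewrite /conjg mulKg.
rewrite -[class_of _ _]/(class_of _ (inv_word [:: (v', true)])) -cls_inv.
by rewrite /conjg invgK -/(gen v') mulgA mulgK.
Qed.

End ExtensionGraph.

(** * The path once around the cycle *)

Section LoopUpperBound.
Variable k : nat.
Hypothesis k_gt1 : 1 < k.
Let N := 3 * k.
Local Notation G := (hubcycle N).
Local Open Scope group_scope.

Fixpoint loop_prefix (i : nat) : raag G :=
  if i is i'.+1 then gen (hub N i') * loop_prefix i' else 1.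

Lemma loop_prefix_pow n : loop_prefix (3 * n)%N = loop_elt k ^+ n.
Proof.
elim: n => [|n IH] //; rewrite mulnS expgS -IH /loop_elt /= !mulgA.
have e m : hub N (3 * n + m)%N = hub N m.
  by apply/eqP; rewrite hub_eq mulnC modnMDl.
by have := e 0%N; have := e 1%N; have := e 2%N; rewrite addn0 addn1 addn2 => -> -> ->.
Qed.

(** As w_i commutes with its hub, conjugating it by the longer prefix changes nothing; the edge to
    w_{i+1} is then conjugated as a whole. *)
Lemma loop_prefix_step i : (i < N)%N ->
  dist_le (ext_gen (rim N i) (loop_prefix i)) (ext_gen (rim N i.+1) (loop_prefix i.+1)) 1.
Proof.
move=> iN; have -> : ext_gen (rim N i) (loop_prefix i) = ext_gen (rim N i) (loop_prefix i.+1).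
  apply: val_inj; rewrite /= conjgM; congr (_ ^ _).
  have c : commute (gen (rim N i)) (gen (hub N i)).
    by apply: gen_commute; rewrite /= inordK ?iN ?eqxx // ltnS ltnW.
  by rewrite /conjg c mulKg.
exact/dist_le_adj/rim_adj.
Qed.

Lemma dist_le_loop :
  dist_le (ext_gen (rim N N) 1) (ext_act (ext_gen (rim N N) 1) (loop_elt k ^+ k)) N.+1.
Proof.
rewrite ext_gen_act mul1g -loop_prefix_pow -/N.
suff h i : (i <= N)%N -> dist_le (ext_gen (rim N N) 1) (ext_gen (rim N i) (loop_prefix i)) i.+1.
  exact: h.
elim: i => [_|i IH iN].
  (* The edge from w_N to w_0 is the one step at which no hub is gained. *)
  apply: dist_le_adj; rewrite adj_sym /= !inordK // !eqxx !orbT andbT.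
  by apply/eqP => /(congr1 val); rewrite /= !inordK // /N; lia.
by have := dist_le_trans (IH (ltnW iN)) (loop_prefix_step iN); rewrite addn1.
Qed.

End LoopUpperBound.

(** * The limit from linear bounds with bounded error *)

Section Limit.
Import Order.TTheory GRing.Theory Num.Theory numFieldNormedType.Exports.
Local Open Scope ring_scope.
Local Open Scope classical_set_scope.

Lemma cvg_translation_length (R : realType) (G : sgraph) (g : raag G)
    (x : ext_vertex G) (l c : R) :
    (forall n, exists2 m, dist_le x (ext_act x (g ^+ n)%g) m & m%:R <= l * n%:R + c) ->
    (forall n m, dist_le x (ext_act x (g ^+ n)%g) m -> l * n%:R <= m%:R + c) ->
  (fun n : nat => (ext_dist R x (ext_act x (g ^+ n)%g) * (n%:R^-1)%:E)%E)
      @ \oo --> l%:E.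
Proof.
move=> ub lb.
have cvgV (a : R) : (fun n : nat => (l + a * n%:R^-1)%:E) @ \oo --> l%:E.
  apply: cvg_EFin; first exact: nearW.
  rewrite -[X in _ --> X]addr0 -[X in _ + X](mulr0 a).
  apply: cvgD; first exact: cvg_cst.
  apply: cvgMr; rewrite gtr0_cvgV0; first exact: cvgr_idn.
  by near=> n; rewrite ltr0n; near: n; exact: nbhs_infty_gt.
apply: squeeze_cvge (cvgV (- c)) (cvgV c); near=> n.
have n0 : 0 < n%:R :> R by rewrite ltr0n; near: n; exact: nbhs_infty_gt.
have dub : (ext_dist R x (ext_act x (g ^+ n)%g) <= (l * n%:R + c)%:E)%E.
  have [m [p [xp lp sp]] mc] := ub n.
  apply: ge_ereal_inf; exists (size p)%:R%:E; first by exists p.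
  by rewrite lee_fin (le_trans _ mc) // ler_nat.
have dlb : ((l * n%:R - c)%:E <= ext_dist R x (ext_act x (g ^+ n)%g))%E.
  apply/ereal_infP => _ [p [xp lp] <-].
  by rewrite lee_fin lerBlDr; apply: lb; exists p.
case: (ext_dist R x _) dub dlb => [d| |] //; rewrite -EFinM !lee_fin => dub dlb.
apply/andP; split.
  by rewrite ler_pdivlMr // mulrDl mulfVK ?gt_eqF.
by rewrite ler_pdivrMr // mulrDl mulfVK ?gt_eqF.
Unshelve. all: by end_near.
Qed.

End Limit.

Import Order.TTheory GRing.Theory Num.Theory.
Local Open Scope ring_scope.

Theorem proposition6p6 (R : realType) (k : nat) (hk : (2 <= k)%N) :
  exists G : sgraph, connected_sgraph G /\
    exists g : raag G,
      syllable_length g = 3%N /\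
      is_asymptotic_translation_length g (3 + 1 / k%:R : R).
Proof.
have k0 : (0 : R) < k%:R by rewrite ltr0n ltnW.
pose o : ext_vertex (hubcycle (3 * k)) := ext_gen (rim (3 * k) (3 * k)) 1%g.
have conn : connected_sgraph (hubcycle (3 * k)) by apply: hubcycle_connected; lia.
exists (hubcycle (3 * k)); split=> //; exists (loop_elt k).
split; first exact: loop_elt_syllable_length.
move=> x; have [D xo] := ext_connected x o conn.
have [E oE] := ext_connected o (ext_act o (loop_elt k)) conn.
(* [2 * D] pays for passing between [x] and [o] at both ends, [k * E] for the n mod k leftover
   factors, and 2 for the loss in the lower bound. *)
pose c := (2 * D + k * E + 2)%N.
have scale (a b : nat) : (k * a <= b)%N -> (a%:R : R) <= b%:R / k%:R.
  by move=> ab; rewrite ler_pdivlMr // -natrM ler_nat mulnC.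
have lE (n : nat) : (3 + 1 / k%:R) * n%:R = (n * (3 * k).+1)%N%:R / k%:R :> R.
  by rewrite natrM -[(3 * k).+1]addn1 natrD natrM; field; rewrite gt_eqF.
have oxn n : dist_le (ext_act o (loop_elt k ^+ n)%g) (ext_act x (loop_elt k ^+ n)%g) D.
  exact/dist_le_act/dist_le_sym.
apply: (@cvg_translation_length R _ _ x _ c%:R) => [n|n m xm].
- exists (D + ((n %% k) * E + (n %/ k) * (3 * k).+1 + D))%N.
    apply: dist_le_trans xo _; apply: dist_le_trans (oxn n).
    (* Full blocks of k factors use the efficient loop of length 3k + 1; the remaining ones cost [E]
       each. *)
    have -> : (loop_elt k ^+ n = (loop_elt k ^+ k) ^+ (n %/ k) * loop_elt k ^+ (n %% k))%g.
      by rewrite -expgnA -expgnDr [(k * _)%N]mulnC -divn_eq.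
    rewrite -ext_actM; apply: dist_le_trans (ext_act_pow _ oE) _.
    exact/dist_le_act/ext_act_pow/dist_le_loop.
  rewrite lE -[c%:R](mulfK (lt0r_neq0 k0)) -mulrDl -natrM -natrD; apply: scale.
  have := divn_eq n k; have := ltn_pmod n (ltnW hk).
  move: (n %% k)%N (n %/ k)%N => r q rk ->; rewrite /c; nia.
- rewrite lE; have := dist_le_trans (dist_le_trans (dist_le_sym xo) xm) (dist_le_sym (oxn n)).
  case=> p [op lp sp].
  have pE : val (last o p) = (gen (rim (3 * k) (3 * k)) ^ loop_elt k ^+ n)%g.
    by rewrite lp /= conjg1.
  have := ext_path_loop_lb hk (conjg1 _ : val o = _) pE op erefl.
  rewrite ler_pdivrMr // -natrD -natrM ler_nat => h; apply: leq_trans h _.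
  by rewrite mulnC leq_mul2r /c; lia.
Qed.
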